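(* Let $(E_6)^\tau=\{\alpha\in E_6\mid\tau\alpha=\alpha\tau\}$ and $(E_6)_E=\{\alpha\in E_6\mid\alpha E=E\}$. Then $$(E_6)^\tau=(E_6)_E\cong F_4.$$
   Context: $\mathbb H$ is the field of quaternions with basis $1,e_1,e_2,e_3$; the Cayley algebra is $\mathfrak C=\mathbb H\oplus\mathbb He_4$ with $(m+ae_4)(n+be_4)=(mn-\overline b a)+(a\overline n+bm)e_4$, $\overline{m+ae_4}=\overline m-ae_4$. $\mathfrak J=\{X\in M(3,\mathfrak C)\mid X^*=X\}$ with $X\circ Y=\frac12(XY+YX)$, $\mathrm{tr}(X)$ the sum of diagonal entries, $(X,Y)=\mathrm{tr}(X\circ Y)$, $X\times Y=\frac12(2X\circ Y-\mathrm{tr}(X)Y-\mathrm{tr}(Y)X+(\mathrm{tr}(X)\mathrm{tr}(Y)-(X,Y))E)$, $\det X=\frac13(X,X\times X)$, $E$ the unit matrix. $F_4$ is the group of $\mathbb R$-linear isomorphisms $\alpha$ of $\mathfrak J$ with $\alpha(X\circ Y)=\alpha X\circ\alpha Y$. $\mathfrak J^{\mathbb C}=\{X_1+iX_2\mid X_j\in\mathfrak J\}$ is the complexification with these operations extended complex (multi)linearly, $\tau(X_1+iX_2)=X_1-iX_2$, $\langle X,Y\rangle=(\tau X,Y)$. $E_6$ is the group of $\mathbb C$-linear isomorphisms $\alpha$ of $\mathfrak J^{\mathbb C}$ with $\det(\alpha X)=\det X$ and $\langle\alpha X,\alpha Y\rangle=\langle X,Y\rangle$. $\cong$ denotes isomorphism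 of groups. *)

(* Defs.v *)
From HB Require Import structures.
From mathcomp Require Import all_boot all_order all_algebra.
From mathcomp Require Import boolp classical_sets functions reals.
From mathcomp Require Import complex ring.

Set Implicit Arguments.
Unset Strict Implicit.
Unset Printing Implicit Defensive.

Import GRing.Theory Num.Theory.
Local Open Scope ring_scope.
Local Open Scope complex_scope.

Section LinearGroup.
Context {K : pzRingType} (V : lmodType K).

Record GL :=
  LinAut { GLfun :> V -> V; GLlin : linear GLfun; GLbij : bijective GLfun }.

HB.instance Definition _ := gen_eqMixin GL.
HB.instance Definition _ := gen_choiceMixin GL.
HB.instance Definition _ (a : GL) :=
  GRing.isLinear.Build K V V *:%R (GLfun a) (GLlin a).

Lemma GL_ext (a b : GL) : a =1 b -> a = b.
Proof.
case: a b => [f fl fb] [g gl gb] /= /funext fg.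
by case: _ / fg in gl gb *; congr LinAut; exact: Prop_irrelevance.
Qed.

Definition GL_one : GL :=
  LinAut (GLfun := id) (fun _ _ _ => erefl)
    (Bijective (g := id) (fun=> erefl) (fun=> erefl)).

Lemma GL_comp_linear (a b : GL) : linear (a \o b).
Proof. by move=> k u v /=; rewrite !linearP. Qed.

Definition GL_mul (a b : GL) : GL :=
  LinAut (@GL_comp_linear a b) (bij_comp (GLbij a) (GLbij b)).

Lemma GL_inv_ex (a : GL) : exists b : GL, cancel a b /\ cancel b a.
Proof.
have [g fg gf] := GLbij a.
have glin : linear g by move=> k u v; rewrite -{1}(gf u) -{1}(gf v) -linearP fg.
by exists (LinAut glin (Bijective gf fg)); split.
Qed.

Definition GL_inv (a : GL) : GL := projT1 (cid (GL_inv_ex a)).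

Lemma GL_mulA : associative GL_mul. Proof. by move=> a b c; apply: GL_ext. Qed.
Lemma GL_mul1 : left_id GL_one GL_mul. Proof. by move=> a; apply: GL_ext. Qed.
Lemma GL_mulr1 : right_id GL_one GL_mul. Proof. by move=> a; apply: GL_ext. Qed.
Lemma GL_mulV : left_inverse GL_one GL_inv GL_mul.
Proof.
by move=> a; apply: GL_ext => x; rewrite /GL_inv /=; case: cid => b /= [].
Qed.
Lemma GL_mulrV : right_inverse GL_one GL_inv GL_mul.
Proof.
by move=> a; apply: GL_ext => x; rewrite /GL_inv /=; case: cid => b /= [].
Qed.

HB.instance Definition _ :=
  isGroup.Build GL GL_mulA GL_mul1 GL_mulr1 GL_mulV GL_mulrV.

Lemma GL1 x : (1%g : GL) x = x. Proof. by []. Qed.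
Lemma GLM (a b : GL) x : (a * b)%g x = a (b x). Proof. by []. Qed.
Lemma GLVK (a : GL) x : a (a^-1%g x) = x.
Proof. by rewrite -GLM mulgV. Qed.

End LinearGroup.

(* Meant for [G] and [H] that are subgroups; the values of [phi] outside [G] are
   irrelevant. *)
Definition isomorphic_subgroups (gT hT : groupType) (G : set gT) (H : set hT) :=
  exists phi : gT -> hT,
    set_bij G H phi /\
    (forall a b, G a -> G b -> phi (a * b)%g = (phi a * phi b)%g).

(* [Quat a b c d] is a + b e_1 + c e_2 + d e_3, with e_1 e_2 = e_3. *)
Record quaternion (R : Type) := Quat { q0 : R; q1 : R; q2 : R; q3 : R }.

Section Quaternion.
Variable R : comNzRingType.
Local Notation H := (quaternion R).

Definition quat_tuple (x : H) := (q0 x, q1 x, q2 x, q3 x).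
Definition tuple_quat (t : R * R * R * R) : H :=
  let: (a, b, c, d) := t in Quat a b c d.
Lemma quat_tupleK : cancel quat_tuple tuple_quat. Proof. by case. Qed.
HB.instance Definition _ := Choice.copy H (can_type quat_tupleK).

Lemma quatP (x y : H) :
  q0 x = q0 y -> q1 x = q1 y -> q2 x = q2 y -> q3 x = q3 y -> x = y.
Proof. by case: x y => [????] [????] /= -> -> -> ->. Qed.

Definition qadd (x y : H) : H :=
  Quat (q0 x + q0 y) (q1 x + q1 y) (q2 x + q2 y) (q3 x + q3 y).
Definition qopp (x : H) : H := Quat (- q0 x) (- q1 x) (- q2 x) (- q3 x).
Definition qscale (a : R) (x : H) : H :=
  Quat (a * q0 x) (a * q1 x) (a * q2 x) (a * q3 x).
Definition qmul (x y : H) : H :=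
  Quat (q0 x * q0 y - q1 x * q1 y - q2 x * q2 y - q3 x * q3 y)
       (q0 x * q1 y + q1 x * q0 y + q2 x * q3 y - q3 x * q2 y)
       (q0 x * q2 y - q1 x * q3 y + q2 x * q0 y + q3 x * q1 y)
       (q0 x * q3 y + q1 x * q2 y - q2 x * q1 y + q3 x * q0 y).

Program Definition quaternion_zmodMixin :=
  @GRing.isZmodule.Build H (Quat 0 0 0 0) qopp qadd _ _ _ _.
Next Obligation. by move=> x y z; apply: quatP => /=; ring. Qed.
Next Obligation. by move=> x y; apply: quatP => /=; ring. Qed.
Next Obligation. by move=> x; apply: quatP => /=; ring. Qed.
Next Obligation. by move=> x; apply: quatP => /=; ring. Qed.
HB.instance Definition _ := quaternion_zmodMixin.

Program Definition quaternion_lmodMixin :=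
  @GRing.Zmodule_isLmodule.Build R H qscale _ _ _ _.
Next Obligation. by apply: quatP => /=; ring. Qed.
Next Obligation. by move=> x; apply: quatP => /=; ring. Qed.
Next Obligation. by move=> a x y; apply: quatP => /=; ring. Qed.
Next Obligation. by move=> a b; apply: quatP => /=; ring. Qed.
HB.instance Definition _ := quaternion_lmodMixin.

Program Definition quaternion_ringMixin :=
  @GRing.Zmodule_isNzRing.Build H (Quat 1 0 0 0) qmul _ _ _ _ _ _.
Next Obligation. by move=> x y z; apply: quatP => /=; ring. Qed.
Next Obligation. by move=> x; apply: quatP => /=; ring. Qed.
Next Obligation. by move=> x; apply: quatP => /=; ring. Qed.
Next Obligation. by move=> x y z; apply: quatP => /=; ring. Qed.
Next Obligation. by move=> x y z; apply: quatP => /=; ring. Qed.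
Next Obligation.
by apply/eqP => /(congr1 (@q0 R)) /= /eqP; rewrite oner_eq0.
Qed.
HB.instance Definition _ := quaternion_ringMixin.

Definition qconj (x : H) : H := Quat (q0 x) (- q1 x) (- q2 x) (- q3 x).

End Quaternion.

(* The pair [(m, a)] is m + a e_4. *)
Definition cayley (R : Type) : Type := (quaternion R * quaternion R)%type.

Section Cayley.
Variable R : comNzRingType.
Local Notation O := (cayley R).

HB.instance Definition _ := GRing.Lmodule.on O.

Definition omul (x y : O) : O :=
  let: (m, a) := x in let: (n, b) := y in
  (m * n - qconj b * a, a * qconj n + b * m).

Definition oconj (x : O) : O := (qconj x.1, - x.2).

Definition oreal (r : R) : O := (Quat r 0 0 0, 0).

Definition oRe (x : O) : R := q0 x.1.

Lemma cayleyP (x y : O) :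
  q0 x.1 = q0 y.1 -> q1 x.1 = q1 y.1 -> q2 x.1 = q2 y.1 -> q3 x.1 = q3 y.1 ->
  q0 x.2 = q0 y.2 -> q1 x.2 = q1 y.2 -> q2 x.2 = q2 y.2 -> q3 x.2 = q3 y.2 ->
  x = y.
Proof.
by case: x y => [??] [??] /= *; congr pair; apply: quatP.
Qed.

Lemma oconjM x y : oconj (omul x y) = omul (oconj y) (oconj x).
Proof. by case: x y => [??] [??]; apply: cayleyP => /=; ring. Qed.

Lemma oconjD x y : oconj (x + y) = oconj x + oconj y.
Proof. by apply: cayleyP => /=; ring. Qed.

Lemma oconjZ a x : oconj (a *: x) = a *: oconj x.
Proof. by apply: cayleyP => /=; ring. Qed.

Lemma oconj0 : oconj 0 = 0.
Proof. by apply: cayleyP => /=; ring. Qed.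

Lemma oconj_sum (I : Type) (r : seq I) (F : I -> O) :
  oconj (\sum_(i <- r) F i) = \sum_(i <- r) oconj (F i).
Proof. exact: (big_morph _ oconjD oconj0). Qed.

Lemma oconj_real r : oconj (oreal r) = oreal r.
Proof. by apply: cayleyP => /=; ring. Qed.

End Cayley.

(* A separate type, because Cayley numbers do not associate: [*m] is not
   available, and the library's scalar action on ['M[T]_3] is by [T], which has
   to be a ring, whereas here R acts. *)
Definition cayley_mx (R : Type) : Type := 'M[cayley R]_3.

Section CayleyMatrix.
Variable R : comNzRingType.
Local Notation M := (cayley_mx R).

HB.instance Definition _ := GRing.Zmodule.on M.

Definition omxscale (a : R) (X : M) : M := \matrix_(i, j) (a *: X i j).

Program Definition cayley_mx_lmodMixin :=
  @GRing.Zmodule_isLmodule.Build R M omxscale _ _ _ _.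
Next Obligation. by apply/matrixP => i j; rewrite !mxE scalerA. Qed.
Next Obligation. by move=> X; apply/matrixP => i j; rewrite !mxE scale1r. Qed.
Next Obligation. by move=> a X Y; apply/matrixP => i j; rewrite !mxE scalerDr. Qed.
Next Obligation. by move=> a b; apply/matrixP => i j; rewrite !mxE scalerDl. Qed.
HB.instance Definition _ := cayley_mx_lmodMixin.

Definition omxmul (X Y : M) : M := \matrix_(i, j) \sum_k omul (X i k) (Y k j).
Definition omxstar (X : M) : M := \matrix_(i, j) oconj (X j i).
Definition omxone : M := \matrix_(i, j) (oreal 1 *+ (i == j)).

Definition hermitian : {pred M} := [pred X | omxstar X == X].

Lemma omxstarD X Y : omxstar (X + Y) = omxstar X + omxstar Y.
Proof. by apply/matrixP => i j; rewrite !mxE oconjD. Qed.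

Lemma omxstarZ a X : omxstar (a *: X) = a *: omxstar X.
Proof. by apply/matrixP => i j; rewrite !mxE oconjZ. Qed.

Lemma omxstarM X Y : omxstar (omxmul X Y) = omxmul (omxstar Y) (omxstar X).
Proof.
apply/matrixP => i j; rewrite !mxE oconj_sum; apply: eq_bigr => k _.
by rewrite oconjM !mxE.
Qed.

Lemma hermitian_submod : submod_closed hermitian.
Proof.
split=> [|a X Y /eqP hX /eqP hY]; rewrite inE.
  by apply/eqP/matrixP => i j; rewrite !mxE oconj0.
by rewrite omxstarD omxstarZ hX hY.
Qed.
HB.instance Definition _ := GRing.isSubmodClosed.Build R M hermitian
  (GRing.submod_closed_semi hermitian_submod).

Lemma omxone_herm : omxone \in hermitian.
Proof.
rewrite inE; apply/eqP/matrixP => i j; rewrite !mxE eq_sym.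
by case: eqP => _; rewrite ?oconj_real ?oconj0.
Qed.

Lemma jordan_herm X Y : X \in hermitian -> Y \in hermitian ->
  omxmul X Y + omxmul Y X \in hermitian.
Proof.
by move=> /eqP hX /eqP hY; rewrite inE omxstarD !omxstarM hX hY addrC.
Qed.

End CayleyMatrix.

Section Jordan.
Variable R : realType.

Record jordan := Jordan { jmx : cayley_mx R; jmxP : jmx \in @hermitian R }.

HB.instance Definition _ := [isSub for jmx].
HB.instance Definition _ := [Choice of jordan by <:].
HB.instance Definition _ := [SubChoice_isSubLmodule of jordan by <:].

Definition jE : jordan := Jordan (omxone_herm R).

Definition jmul (X Y : jordan) : jordan :=
  2^-1 *: Jordan (jordan_herm (jmxP X) (jmxP Y)).

(* The diagonal entries of an element of the Jordan algebra are real, so the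
   trace is the real number [jtr X]; see [jtrE]. *)
Definition jtr (X : jordan) : R := \sum_i oRe ((jmx X : 'M_3) i i).

Lemma jtrE (X : jordan) : \sum_i (jmx X : 'M_3) i i = oreal (jtr X).
Proof.
have orealD (r s : R) : oreal (r + s) = oreal r + oreal s.
  by apply: cayleyP => /=; ring.
have oreal0 : oreal (0 : R) = 0 by apply: cayleyP.
rewrite /jtr (big_morph _ orealD oreal0); apply: eq_bigr => i _.
have /eqP/matrixP/(_ i i) := jmxP X; rewrite mxE.
case: (fun_of_matrix _ _ _) => [[a b c d] [a' b' c' d']] [].
have N0 (x : R) : - x = x -> x = 0.
  by move=> /eqP; rewrite eq_sym -subr_eq0 opprK -mulr2n mulrn_eq0 => /eqP.
by do 7![move=> /N0 ->].
Qed.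

Definition jip (X Y : jordan) : R := jtr (jmul X Y).

Definition jcross (X Y : jordan) : jordan :=
  2^-1 *: (2 *: jmul X Y - jtr X *: Y - jtr Y *: X
           + (jtr X * jtr Y - jip X Y) *: jE).

Definition F4 : set (GL jordan) :=
  [set a | forall X Y, a (jmul X Y) = jmul (a X) (a Y)].

End Jordan.

(* [Cplx x y] is x + i y. *)
Record cplx (V : Type) := Cplx { cplx_re : V; cplx_im : V }.

Section Complexification.
Variables (R : realType) (V : lmodType R).
Local Notation VC := (cplx V).

Definition cplx_pair (X : VC) := (cplx_re X, cplx_im X).
Definition pair_cplx (p : V * V) : VC := Cplx p.1 p.2.
Lemma cplx_pairK : cancel cplx_pair pair_cplx. Proof. by case. Qed.
HB.instance Definition _ := Choice.copy VC (can_type cplx_pairK).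

Lemma cplxP (X Y : VC) :
  cplx_re X = cplx_re Y -> cplx_im X = cplx_im Y -> X = Y.
Proof. by case: X Y => [??] [??] /= -> ->. Qed.

Definition cplx_add (X Y : VC) : VC :=
  Cplx (cplx_re X + cplx_re Y) (cplx_im X + cplx_im Y).
Definition cplx_opp (X : VC) : VC := Cplx (- cplx_re X) (- cplx_im X).
Definition cplx_scale (z : R[i]) (X : VC) : VC :=
  Cplx (complex.Re z *: cplx_re X - complex.Im z *: cplx_im X)
       (complex.Re z *: cplx_im X + complex.Im z *: cplx_re X).

Program Definition cplx_zmodMixin :=
  @GRing.isZmodule.Build VC (Cplx 0 0) cplx_opp cplx_add _ _ _ _.
Next Obligation. by move=> X Y Z; apply: cplxP => /=; rewrite addrA. Qed.
Next Obligation. by move=> X Y; apply: cplxP => /=; rewrite addrC. Qed.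
Next Obligation. by move=> X; apply: cplxP => /=; rewrite add0r. Qed.
Next Obligation. by move=> X; apply: cplxP => /=; rewrite addNr. Qed.
HB.instance Definition _ := cplx_zmodMixin.

Program Definition cplx_lmodMixin :=
  @GRing.Zmodule_isLmodule.Build R[i] VC cplx_scale _ _ _ _.
Next Obligation.
case: a b v => [a a'] [b b'] [x y]; apply: cplxP => /=;
  rewrite !(scalerBr, scalerDr) !scalerA !(scalerBl, scalerDl) ?opprD;
  by rewrite [X in _ + X = _]addrC addrACA.
Qed.
Next Obligation.
by move=> X; apply: cplxP => /=; rewrite scale1r scale0r ?subr0 ?addr0.
Qed.
Next Obligation.
by move=> z X Y; apply: cplxP => /=; rewrite !scalerDr ?opprD addrACA.
Qed.
Next Obligation.
by move=> [a a'] [b b']; apply: cplxP => /=; rewrite !scalerDl ?opprD addrACA.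
Qed.
HB.instance Definition _ := cplx_lmodMixin.

Definition cplx_conj (X : VC) : VC := Cplx (cplx_re X) (- cplx_im X).

(* The complex bilinear extensions of R-bilinear maps. *)
Definition cplx_bilin (f : V -> V -> V) (X Y : VC) : VC :=
  Cplx (f (cplx_re X) (cplx_re Y) - f (cplx_im X) (cplx_im Y))
       (f (cplx_re X) (cplx_im Y) + f (cplx_im X) (cplx_re Y)).

Definition cplx_form (f : V -> V -> R) (X Y : VC) : R[i] :=
  (f (cplx_re X) (cplx_re Y) - f (cplx_im X) (cplx_im Y))
  +i* (f (cplx_re X) (cplx_im Y) + f (cplx_im X) (cplx_re Y)).

End Complexification.

Section E6.
Variable R : realType.
Local Notation JC := (cplx (jordan R)).

Definition JC_E : JC := Cplx (jE R) 0.
Definition tau (X : JC) : JC := cplx_conj X.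
Definition JC_ip (X Y : JC) : R[i] := cplx_form (@jip R) X Y.
Definition JC_cross (X Y : JC) : JC := cplx_bilin (@jcross R) X Y.
Definition JC_det (X : JC) : R[i] := 3^-1 * JC_ip X (JC_cross X X).
Definition JC_herm (X Y : JC) : R[i] := JC_ip (tau X) Y.

Definition E6 : set (GL JC) :=
  [set a | (forall X, JC_det (a X) = JC_det X) /\
           (forall X Y, JC_herm (a X) (a Y) = JC_herm X Y)].

Definition E6_tau : set (GL JC) :=
  [set a | E6 a /\ (forall X, tau (a X) = a (tau X))].

Definition E6_E : set (GL JC) := [set a | E6 a /\ a JC_E = JC_E].

End E6.

Arguments F4 : clear implicits.
Arguments E6 : clear implicits.
Arguments E6_tau : clear implicits.
Arguments E6_E : clear implicits.

Section Subgroups.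
Variable R : realType.

Lemma set_group_closed (gT : groupType) (G : set gT) :
  G 1%g -> (forall a b, G a -> G b -> G (a * b^-1)%g) -> group_closed [in G].
Proof. by move=> G1 GD; split=> [|a b]; rewrite !inE //; exact: GD. Qed.

Lemma F4_group : group_closed [in F4 R].
Proof.
apply: set_group_closed => [X Y|a b ha hb X Y]; first by rewrite !GL1.
rewrite !GLM -ha; congr (a _); apply: (bij_inj (GLbij b)).
by rewrite hb !GLVK.
Qed.

Lemma E6_1 : E6 R 1%g.
Proof. by split=> [X|X Y]; rewrite !GL1. Qed.

Lemma E6_div a b : E6 R a -> E6 R b -> E6 R (a * b^-1)%g.
Proof.
move=> [ad ah] [bd bh]; split=> [X|X Y].
  by rewrite GLM ad -bd GLVK.
by rewrite !GLM ah -bh !GLVK.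
Qed.

Lemma E6_group : group_closed [in E6 R].
Proof. exact: set_group_closed E6_1 E6_div. Qed.

Lemma E6_tau_group : group_closed [in E6_tau R].
Proof.
apply: set_group_closed => [|a b [a6 at_] [b6 bt]].
  by split=> [|X]; [exact: E6_1|rewrite !GL1].
split; first exact: E6_div.
move=> X; rewrite !GLM at_; congr (a _).
by apply: (bij_inj (GLbij b)); rewrite -bt !GLVK.
Qed.

Lemma E6_E_group : group_closed [in E6_E R].
Proof.
apply: set_group_closed => [|a b [a6 aE] [b6 bE]].
  by split; [exact: E6_1|rewrite GL1].
split; first exact: E6_div.
rewrite GLM; suff -> : (b^-1%g : GL _) (JC_E R) = JC_E R by [].
by apply: (bij_inj (GLbij b)); rewrite GLVK bE.
Qed.

End Subgroups.

(* Main.v *)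
Require Import Defs.
From mathcomp Require Import all_boot all_order all_algebra.
From mathcomp Require Import classical_sets reals.
From mathcomp Require Import boolp complex ring lra.

Set Implicit Arguments.
Unset Strict Implicit.
Unset Printing Implicit Defensive.

Import GRing.Theory Num.Theory.
Local Open Scope ring_scope.
Local Open Scope complex_scope.

(** Everything is governed by the symmetric trilinear form (X, Y x Z), whose
    diagonal is 3 det.

    An element of E_6 preserves this form, not only det: the form is symmetric
    because the trace form is associative ([jformCl]), so polarization
    recovers it from its diagonal ([trilinear_polarization], [E6_form]).
    Evaluating one argument at E gives
      2 (E, Y x Z) = (E, Y)(E, Z) - (Y, Z)   with (E, E) = 3.

    If alpha in E_6 fixes E, this identity with Y = E shows that alpha
    preserves (E, Z), that is the trace, and then that it preserves (Y, Z).
    Preserving both (Y, Z) and (tau Y, Z), with (Y, Z) nondegenerate, it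
    commutes with tau ([E6_E_tau]).

    Conversely, if alpha commutes with tau, it is the complexification of a
    linear isomorphism b of J that preserves the real inner product and the
    trilinear form. The image P = b E then satisfies the same identity as E:
      2 (P, Y x Z) = (P, Y)(P, Z) - (Y, Z)   with (P, P) = 3.
    This alone forces P = E ([jform_unit_rigid]). Take for Y = Z an element U
    with x at (i, j), its conjugate at (j, i) and zeros elsewhere, where x is
    orthogonal to the corresponding entry of P, so that (P, U) = 0. Since U is
    traceless and its square is |x|^2 times the sum of two diagonal
    idempotents, the identity says that the third diagonal entry of P is 1.
    Hence tr P = 3 and |P - E|^2 = 3 - 6 + 3 = 0.

    It remains to see that complexification maps F_4 bijectively onto the
    stabilizer of E. If b preserves E, the inner product and the trilinear
    form, then it preserves the trilinear form (X, Y o Z), hence the product.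
    If b preserves the product, then it fixes the unit E, and the missing point
    is that it preserves the trace, for then it preserves all the forms. The
    functional tr b is again associative, and a linear functional with this
    property is a multiple of tr ([associative_traceE]); comparing the values
    at E gives tr b = tr. *)

(** * Cayley numbers *)

Section CayleyAlgebra.
Variable R : comNzRingType.
Implicit Types x y z : cayley R.

Lemma omulDl x y z : omul (x + y) z = omul x z + omul y z.
Proof. by case: x y z => [? ?] [? ?] [? ?]; apply: cayleyP => /=; ring. Qed.

Lemma omulDr x y z : omul x (y + z) = omul x y + omul x z.
Proof. by case: x y z => [? ?] [? ?] [? ?]; apply: cayleyP => /=; ring. Qed.

Lemma omul0l x : omul 0 x = 0.
Proof. by case: x => [? ?]; apply: cayleyP => /=; ring. Qed.

Lemma omul0r x : omul x 0 = 0.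
Proof. by case: x => [? ?]; apply: cayleyP => /=; ring. Qed.

Lemma omul1l x : omul (oreal 1) x = x.
Proof. by case: x => [? ?]; apply: cayleyP => /=; ring. Qed.

Lemma omul1r x : omul x (oreal 1) = x.
Proof. by case: x => [? ?]; apply: cayleyP => /=; ring. Qed.

Lemma oRe_mulC x y : oRe (omul x y) = oRe (omul y x).
Proof. by case: x y => [? ?] [? ?]; rewrite /oRe /=; ring. Qed.

(** Cayley numbers do not associate, but an associator has no real part; this is
    what makes the trace form of the Jordan algebra associative. *)
Lemma oRe_mulA x y z : oRe (omul (omul x y) z) = oRe (omul x (omul y z)).
Proof. by case: x y z => [? ?] [? ?] [? ?]; rewrite /oRe /=; ring. Qed.

Lemma oRe_mulZr a x y : oRe (omul x (a *: y)) = a * oRe (omul x y).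
Proof. by case: x y => [? ?] [? ?]; rewrite /oRe /=; ring. Qed.

Definition onorm x : R := oRe (omul x (oconj x)).

Lemma onormE x : onorm x =
  q0 x.1 ^+ 2 + q1 x.1 ^+ 2 + q2 x.1 ^+ 2 + q3 x.1 ^+ 2
  + q0 x.2 ^+ 2 + q1 x.2 ^+ 2 + q2 x.2 ^+ 2 + q3 x.2 ^+ 2.
Proof. by case: x => [? ?]; rewrite /onorm /oRe /=; ring. Qed.

Lemma omul_conjr x : omul x (oconj x) = oreal (onorm x).
Proof. by rewrite onormE; case: x => [? ?]; apply: cayleyP => /=; ring. Qed.

Lemma omul_conjl x : omul (oconj x) x = oreal (onorm x).
Proof. by rewrite onormE; case: x => [? ?]; apply: cayleyP => /=; ring. Qed.

Lemma cayley_conjK : involutive (@oconj R).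
Proof. by move=> x; apply: cayleyP => /=; ring. Qed.

Lemma omul_suml (I : finType) (F : I -> cayley R) x :
  omul (\sum_i F i) x = \sum_i omul (F i) x.
Proof.
by apply: (big_morph (fun y => omul y x)) => [? ?|]; rewrite ?omulDl ?omul0l.
Qed.

Lemma omul_sumr (I : finType) (F : I -> cayley R) x :
  omul x (\sum_i F i) = \sum_i omul x (F i).
Proof. by apply: (big_morph (omul x)) => [? ?|]; rewrite ?omulDr ?omul0r. Qed.

Lemma oRe_sum (I : finType) (F : I -> cayley R) :
  oRe (\sum_i F i) = \sum_i oRe (F i).
Proof. by apply: (big_morph (@oRe R)) => [? ?|]. Qed.

End CayleyAlgebra.

(** * Matrices of Cayley numbers *)

Section CayleyMatrices.
Variable R : comNzRingType.
Implicit Types A B C : cayley_mx R.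

Definition retr A : R := \sum_i oRe ((A : 'M_3) i i).

Lemma retrD A B : retr (A + B) = retr A + retr B.
Proof. by rewrite -big_split; apply: eq_bigr => i _; rewrite mxE. Qed.

Lemma retrZ a A : retr (a *: A) = a * retr A.
Proof. by rewrite /retr big_distrr; apply: eq_bigr => i _; rewrite mxE. Qed.

Lemma retrM A B :
  retr (omxmul A B) =
  \sum_i \sum_j oRe (omul ((A : 'M_3) i j) ((B : 'M_3) j i)).
Proof. by rewrite /retr; apply: eq_bigr => i _; rewrite mxE oRe_sum. Qed.

Lemma retrMC A B : retr (omxmul A B) = retr (omxmul B A).
Proof.
rewrite !retrM exchange_big; apply: eq_bigr => i _; apply: eq_bigr => j _.
exact: oRe_mulC.
Qed.

Lemma retrMA A B C :
  retr (omxmul (omxmul A B) C) = retr (omxmul A (omxmul B C)).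
Proof.
rewrite !retrM; apply: eq_bigr => i _.
under eq_bigr => j _ do rewrite mxE omul_suml oRe_sum.
under [RHS]eq_bigr => j _ do rewrite mxE omul_sumr oRe_sum.
rewrite exchange_big; apply: eq_bigr => j _; apply: eq_bigr => k _.
exact: oRe_mulA.
Qed.

Lemma omxmulDl A B C : omxmul (A + B) C = omxmul A C + omxmul B C.
Proof.
apply/matrixP => i j; rewrite !mxE -big_split.
by apply: eq_bigr => k _; rewrite !mxE omulDl.
Qed.

Lemma omxmulDr A B C : omxmul A (B + C) = omxmul A B + omxmul A C.
Proof.
apply/matrixP => i j; rewrite !mxE -big_split.
by apply: eq_bigr => k _; rewrite !mxE omulDr.
Qed.

Lemma omxmul1l A : omxmul (omxone R) A = A.
Proof.
apply/matrixP => i j; rewrite !mxE (bigD1 i) //= big1 => [|k ki]; rewrite !mxE.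
  by rewrite eqxx omul1l addr0.
by rewrite eq_sym (negbTE ki) omul0l.
Qed.

Lemma omxmul1r A : omxmul A (omxone R) = A.
Proof.
apply/matrixP => i j; rewrite !mxE (bigD1 j) //= big1 => [|k kj]; rewrite !mxE.
  by rewrite eqxx omul1r addr0.
by rewrite (negbTE kj) omul0r.
Qed.

Definition omxunit (i j : 'I_3) (x : cayley R) : cayley_mx R :=
  \matrix_(k, l) (x *+ ((k == i) && (l == j))).

Lemma omxunitM i j k l x y :
  omxmul (omxunit i j x) (omxunit k l y) = omxunit i l (omul x y) *+ (j == k).
Proof.
apply/matrixP => a b; rewrite !mxE (bigD1 j) //= big1 => [|c cj]; last first.
  by rewrite !mxE (negbTE cj) andbF omul0l.
rewrite !mxE eqxx andbT addr0.
case: (j == k); rewrite ?mulr1n ?mulr0n !mxE; last first.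
  by rewrite omul0r.
rewrite andTb.
by case: (a == i); case: (b == l); rewrite ?mulr1n ?mulr0n ?omul0l ?omul0r.
Qed.

Lemma omxunit_star i j x : omxstar (omxunit i j x) = omxunit j i (oconj x).
Proof.
apply/matrixP => a b; rewrite !mxE andbC.
by case: (_ && _); rewrite ?mulr1n ?mulr0n ?oconj0.
Qed.

End CayleyMatrices.

(** * The trace form and the trilinear form *)

Definition jform (R : realType) (X Y Z : jordan R) : R := jip X (jcross Y Z).

(** The decision procedures compare their atoms up to conversion, which unfolds
    traces of products of Cayley matrices; abstracting the atoms first keeps
    them fast. *)
Ltac jatoms :=
  repeat match goal with
  | |- context [@jform ?R ?X ?Y ?Z] => generalize (@jform R X Y Z) => ?
  | |- context [@jip ?R ?X ?Y] => generalize (@jip R X Y) => ?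
  | |- context [@jtr ?R ?X] => generalize (@jtr R X) => ?
  end.

Section TraceForm.
Variable R : realType.
Implicit Types X Y Z W : jordan R.

Lemma jmxP_inj X Y : jmx X = jmx Y -> X = Y.
Proof. exact: val_inj. Qed.

Lemma jmxD X Y : jmx (X + Y) = jmx X + jmx Y. Proof. by []. Qed.
Lemma jmxZ a X : jmx (a *: X) = a *: jmx X. Proof. by []. Qed.

Lemma jmx_conj X i j : oconj ((jmx X : 'M_3) i j) = (jmx X : 'M_3) j i.
Proof. by have /eqP/matrixP/(_ j i) := jmxP X; rewrite mxE. Qed.

Lemma jmulC X Y : jmul X Y = jmul Y X.
Proof. by congr (_ *: _); apply: jmxP_inj; rewrite /= addrC. Qed.

Lemma jmul1l X : jmul (jE R) X = X.
Proof.
apply: jmxP_inj; rewrite /= omxmul1l omxmul1r -mulr2n -scaler_nat scalerA.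
by rewrite mulVf ?scale1r // pnatr_eq0.
Qed.

Lemma jipE X Y : jip X Y = retr (omxmul (jmx X) (jmx Y)).
Proof.
rewrite /jip -[jtr _]/(retr (jmx _)) /= retrZ retrD [X in _ + X]retrMC.
by field.
Qed.

Lemma jip_sum X Y : jip X Y =
  \sum_i \sum_j oRe (omul ((jmx X : 'M_3) i j) ((jmx Y : 'M_3) j i)).
Proof. by rewrite jipE retrM. Qed.

Lemma jipC X Y : jip X Y = jip Y X.
Proof. by rewrite /jip jmulC. Qed.

Lemma jipDl X Y Z : jip (X + Y) Z = jip X Z + jip Y Z.
Proof. by rewrite !jipE jmxD omxmulDl retrD. Qed.

Lemma jipDr X Y Z : jip X (Y + Z) = jip X Y + jip X Z.
Proof. by rewrite !(jipC X) jipDl. Qed.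

Lemma jipZr a X Y : jip X (a *: Y) = a * jip X Y.
Proof.
rewrite !jip_sum jmxZ big_distrr; apply: eq_bigr => i _.
rewrite big_distrr; apply: eq_bigr => j _.
by rewrite mxE oRe_mulZr.
Qed.

Lemma jipZl a X Y : jip (a *: X) Y = a * jip X Y.
Proof. by rewrite jipC jipZr jipC. Qed.

Lemma jipNr X Y : jip X (- Y) = - jip X Y.
Proof. by rewrite -scaleN1r jipZr mulN1r. Qed.

Lemma jipNl X Y : jip (- X) Y = - jip X Y.
Proof. by rewrite jipC jipNr jipC. Qed.

Lemma jip0r X : jip X 0 = 0.
Proof. by rewrite -(scale0r 0) jipZr mul0r. Qed.

Lemma jip0l X : jip 0 X = 0.
Proof. by rewrite jipC jip0r. Qed.

(** Both sides are half a sum of two real traces of products of three matrices,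
    and the real trace of a product is associative and cyclic. *)
Lemma jip_mulA X Y Z : jip (jmul X Y) Z = jip X (jmul Y Z).
Proof.
rewrite jipZl jipZr !jipE /= omxmulDl omxmulDr !retrD !retrMA.
by rewrite [X in _ + X]retrMC retrMA.
Qed.

Lemma jtr_jmul X Y : jtr (jmul X Y) = jip X Y. Proof. by []. Qed.

Lemma jip1l X : jip (jE R) X = jtr X.
Proof. by rewrite /jip jmul1l. Qed.

Lemma jtr1 : jtr (jE R) = 3.
Proof.
rewrite /jtr (eq_bigr (fun=> 1)) => [|i _]; last by rewrite mxE eqxx.
by rewrite sumr_const card_ord.
Qed.

Lemma jip_norm X : jip X X = \sum_i \sum_j onorm ((jmx X : 'M_3) i j).
Proof.
rewrite jip_sum; apply: eq_bigr => i _; apply: eq_bigr => j _.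
by rewrite -[(jmx X : 'M_3) j i]jmx_conj.
Qed.

Lemma onorm_ge0 (x : cayley R) : 0 <= onorm x.
Proof. by rewrite onormE !addr_ge0 ?sqr_ge0. Qed.

Lemma onorm_eq0 (x : cayley R) : onorm x = 0 -> x = 0.
Proof.
move/eqP; rewrite onormE !paddr_eq0 ?addr_ge0 ?sqr_ge0 // !sqrf_eq0 -!andbA.
by do 7![case/andP => /eqP ?]; move/eqP => ?; apply: cayleyP.
Qed.

Lemma jip_eq0 X : jip X X = 0 -> X = 0.
Proof.
move/eqP; rewrite jip_norm psumr_eq0 => [/allP X0|i _]; last first.
  by apply: sumr_ge0 => ? _; apply: onorm_ge0.
apply: jmxP_inj; apply/matrixP => i j; rewrite [RHS]mxE; apply: onorm_eq0.
have := X0 i (mem_index_enum _); rewrite psumr_eq0 => [|? _]; last first.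
  exact: onorm_ge0.
by move/allP/(_ j (mem_index_enum _))/eqP.
Qed.

Lemma jip_inj X Y : (forall Z, jip X Z = jip Y Z) -> X = Y.
Proof.
move=> XY; apply/eqP; rewrite -subr_eq0; apply/eqP/jip_eq0.
by rewrite jipDl jipNl XY subrr.
Qed.

Lemma jtrD X Y : jtr (X + Y) = jtr X + jtr Y.
Proof. by rewrite -!jip1l jipDr. Qed.

Lemma jtrZ a X : jtr (a *: X) = a * jtr X.
Proof. by rewrite -!jip1l jipZr. Qed.

(** Apart from (X, Y o Z), the trilinear form is a visibly symmetric expression
    in the trace and the inner product. *)
Lemma jformE X Y Z : jform X Y Z =
  jip X (jmul Y Z) + 2^-1 * (jtr X * jtr Y * jtr Z
    - jtr X * jip Y Z - jtr Y * jip X Z - jtr Z * jip X Y).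
Proof.
rewrite /jform /jcross; move: (jmul Y Z) => W.
rewrite jipZr !(jipDr, jipNr, jipZr) [jip X (jE R)]jipC jip1l.
by jatoms; field.
Qed.

Lemma jformCr X Y Z : jform X Y Z = jform X Z Y.
Proof. by rewrite !jformE (jmulC Y) (jipC Y); jatoms; ring. Qed.

Lemma jformCl X Y Z : jform X Y Z = jform Y X Z.
Proof.
by rewrite !jformE -!jip_mulA (jmulC Y) (jipC Y X); jatoms; ring.
Qed.

Lemma jform0l X Y : jform 0 X Y = 0.
Proof. exact: jip0l. Qed.

Lemma jform1l X Y : jform (jE R) X Y = 2^-1 * (jtr X * jtr Y - jip X Y).
Proof. by rewrite jformE !jip1l jtr1 jtr_jmul; jatoms; field. Qed.

End TraceForm.

(** * Hermitian matrix units *)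

Section HermitianUnits.
Variable R : realType.
Implicit Types (X Y Z : jordan R) (x : cayley R).

(** Products are computed with this lemma, which clears the factor 1/2. *)
Lemma jmulP X Y Z :
  omxmul (jmx X) (jmx Y) + omxmul (jmx Y) (jmx X) = 2 *: jmx Z -> jmul X Y = Z.
Proof.
move=> XYZ; apply: jmxP_inj; rewrite /= XYZ scalerA mulVf ?scale1r //.
by rewrite pnatr_eq0.
Qed.

Lemma jmulDl X Y Z : jmul (X + Y) Z = jmul X Z + jmul Y Z.
Proof. by apply: jip_inj => W; rewrite jipDl !jip_mulA jipDl. Qed.

Lemma jmulZl a X Y : jmul (a *: X) Y = a *: jmul X Y.
Proof. by apply: jip_inj => W; rewrite jipZl !jip_mulA jipZl. Qed.

Lemma hunit_herm i j x :
  omxunit i j x + omxunit j i (oconj x) \in @Defs.hermitian R.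
Proof. by rewrite inE omxstarD !omxunit_star cayley_conjK addrC. Qed.

Definition hunit i j x := Jordan (hunit_herm i j x).

Lemma jdiag_herm i : omxunit i i (oreal 1) \in @Defs.hermitian R.
Proof. by rewrite inE omxunit_star oconj_real. Qed.

Definition jdiag i := Jordan (jdiag_herm i).

Lemma omxunitZ i j a x : a *: omxunit i j x = omxunit i j (a *: x).
Proof. by apply/matrixP => k l; rewrite !mxE scalerMnr. Qed.

Lemma omxunitD i j x y : omxunit i j x + omxunit i j y = omxunit i j (x + y).
Proof. by apply/matrixP => k l; rewrite !mxE mulrnDl. Qed.

(** On the diagonal the two terms of [hunit] overlap, and only the real part of
    the entry survives. *)
Lemma hunit_diag i x : hunit i i x = (2 * oRe x) *: jdiag i.
Proof.
apply: jmxP_inj; rewrite jmxZ /= omxunitZ omxunitD; congr omxunit.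
by case: x => [? ?]; apply: cayleyP; rewrite /oRe /=; ring.
Qed.

Lemma jip_hunit X i j x :
  jip X (hunit i j x) = 2 * oRe (omul ((jmx X : 'M_3) j i) x).
Proof.
have unitr k l y :
    retr (omxmul (jmx X) (omxunit k l y)) = oRe (omul ((jmx X : 'M_3) l k) y).
  rewrite retrM (bigD1 l) //= [X in _ + X]big1 => [|m ml]; last first.
    by rewrite big1 // => n _; rewrite mxE (negbTE ml) andbF omul0r.
  rewrite addr0 (bigD1 k) //= big1 => [|n nk]; last first.
    by rewrite mxE (negbTE nk) omul0r.
  by rewrite mxE !eqxx addr0.
rewrite jipE /= omxmulDr retrD !unitr.
have -> : oRe (omul ((jmx X : 'M_3) i j) (oconj x)) =
          oRe (omul ((jmx X : 'M_3) j i) x).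
  by rewrite -jmx_conj -oconjM oRe_mulC.
by ring.
Qed.

Lemma jip_sumr (I : finType) X (F : I -> jordan R) :
  jip X (\sum_i F i) = \sum_i jip X (F i).
Proof. by apply: (big_morph (jip X)) => [? ?|]; rewrite ?jipDr ?jip0r. Qed.

Lemma hunit_sum X : X = 2^-1 *: \sum_i \sum_j hunit i j ((jmx X : 'M_3) i j).
Proof.
apply: jip_inj => Z; rewrite [LHS]jipC [RHS]jipC jipZr jip_sumr jip_sum.
rewrite exchange_big big_distrr; apply: eq_bigr => i _.
rewrite jip_sumr big_distrr; apply: eq_bigr => j _.
by rewrite jip_hunit /= mulKf ?pnatr_eq0.
Qed.

Lemma jdiag_idem i : jmul (jdiag i) (jdiag i) = jdiag i.
Proof.
by apply: jmulP; rewrite /= omxunitM eqxx omul1l -mulr2n scaler_nat.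
Qed.

Lemma jdiag_ortho i j : i != j -> jmul (jdiag i) (jdiag j) = 0.
Proof.
move=> ij; apply: jmulP; rewrite /= !omxunitM [j == i]eq_sym.
by rewrite (negbTE ij) !mulr0n addr0 scaler0.
Qed.

Lemma jdiag_hunit i j x : i != j ->
  jmul (jdiag i) (hunit i j x) = 2^-1 *: hunit i j x.
Proof.
move=> ij; apply: jmulP; rewrite jmxZ scalerA divff ?pnatr_eq0 //.
rewrite scale1r /= omxmulDl omxmulDr !omxunitM eqxx [j == i]eq_sym.
by rewrite (negbTE ij) !mulr1n !mulr0n addr0 add0r omul1l omul1r.
Qed.

Lemma hunit_sqr i j x : i != j ->
  jmul (hunit i j x) (hunit i j x) = onorm x *: (jdiag i + jdiag j).
Proof.
move=> ij; apply: jmulP; rewrite jmxZ jmxD /=.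
rewrite !omxmulDl !omxmulDr !omxunitM !eqxx [j == i]eq_sym.
rewrite (negbTE ij) !mulr1n !mulr0n !addr0 !add0r omul_conjr omul_conjl.
rewrite -mulr2n -scaler_nat; congr (2 *: _); rewrite scalerDr !omxunitZ.
by congr (omxunit _ _ _ + omxunit _ _ _); apply: cayleyP => /=; ring.
Qed.

(** * Associative functionals and the trace *)

Section Associators.
Variable f : jordan R -> R.
Hypothesis fD : forall X Y, f (X + Y) = f X + f Y.
Hypothesis fZ : forall a X, f (a *: X) = a * f X.
Hypothesis fA : forall X Y Z, f (jmul (jmul X Y) Z) = f (jmul X (jmul Y Z)).

(** With e = [jdiag i] and e o U = U / 2, the associator of e, e, U is U / 4. *)
Lemma assoc_hunit0 i j x : i != j -> f (hunit i j x) = 0.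
Proof.
move=> ij; have := fA (jdiag i) (jdiag i) (hunit i j x).
rewrite jdiag_idem jdiag_hunit // [jmul _ (_ *: _)]jmulC jmulZl jmulC.
by rewrite jdiag_hunit // !fZ => fU; lra.
Qed.

(** With U = [hunit i j 1], e_i = [jdiag i] and e_j = [jdiag j], the associator
    of U, U, e_i is (e_i - e_j) / 2. *)
Lemma assoc_jdiag i j : f (jdiag i) = f (jdiag j).
Proof.
have [->//|ij] := eqVneq i j.
have := fA (hunit i j (oreal 1)) (hunit i j (oreal 1)) (jdiag i).
have norm1 : onorm (oreal 1) = 1 :> R by rewrite onormE /=; ring.
rewrite hunit_sqr // norm1 (jmulC (hunit _ _ _) (jdiag i)) jdiag_hunit //.
rewrite (jmulC (hunit _ _ _) (_ *: _)) !jmulZl hunit_sqr //.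
rewrite norm1 jmulDl jdiag_idem.
by rewrite (jmulC (jdiag j)) jdiag_ortho // addr0 !fZ !fD => fU; lra.
Qed.

(** The off-diagonal Hermitian units and the differences of diagonal idempotents
    span the traceless elements, and they are multiples of associators. *)
Lemma associative_traceE X : f X = f (jdiag ord0) * jtr X.
Proof.
have f0 : f 0 = 0 by rewrite -(scale0r 0) fZ mul0r.
have f_sum (F : 'I_3 -> jordan R) : f (\sum_i F i) = \sum_i f (F i).
  by apply: (big_morph f).
rewrite {1}(hunit_sum X) fZ f_sum /jtr !big_distrr.
apply: eq_bigr => i _; rewrite f_sum (bigD1 i) //= big1 => [|j ji]; last first.
  by rewrite assoc_hunit0 // eq_sym.
rewrite addr0 hunit_diag fZ (assoc_jdiag i ord0) /= -!mulrA mulKf ?pnatr_eq0 //.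
exact: mulrC.
Qed.

End Associators.

(** * Rigidity of the unit *)

Lemma jtr_hunit i j x : i != j -> jtr (hunit i j x) = 0.
Proof.
apply: (assoc_hunit0 (@jtrZ R)) => X Y Z.
by rewrite !jtr_jmul jip_mulA.
Qed.

Lemma jip_jdiag X i : jip X (jdiag i) = oRe ((jmx X : 'M_3) i i).
Proof.
have := jip_hunit X i i (oreal 1); rewrite hunit_diag jipZr omul1r mulr1.
by apply: mulfI; rewrite pnatr_eq0.
Qed.

Lemma jtr_jdiag i : jtr (jdiag i) = 1.
Proof. by rewrite -jip1l jip_jdiag mxE eqxx. Qed.

Lemma exists_orthogonal (p : cayley R) :
  exists2 x, onorm x != 0 & oRe (omul p x) = 0.
Proof.
have [p0|p0] := eqVneq (q0 p.1) 0.
  exists (oreal 1); last by rewrite omul1r.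
  by rewrite onormE /= expr1n expr0n !addr0 oner_eq0.
(* (q1 p, q0 p) is orthogonal to the first two coordinates (q0 p, - q1 p) of the
   linear functional oRe (omul p _). *)
exists (Quat (q1 p.1) (q0 p.1) 0 0, 0).
  rewrite onormE /= expr0n !addr0 paddr_eq0 ?sqr_ge0 // !sqrf_eq0.
  by rewrite (negbTE p0) andbF.
by case: p {p0} => [? ?]; rewrite /oRe /=; ring.
Qed.

(** The conditions P x P = P and (P, P) = 3 would not suffice, since
    diag(1, -1, -1) satisfies both. Off-diagonal test elements Y = Z exclude it:
    they give tr P = 3, hence (P - E, P - E) = 0. *)
Lemma jform_unit_rigid P :
    (forall Y Z, jform P Y Z = 2^-1 * (jip P Y * jip P Z - jip Y Z)) ->
  jip P P = 3 -> P = jE R.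
Proof.
move=> PE PP.
have diag i j : i != j ->
    jtr P = jip P (jdiag i) + jip P (jdiag j) + 1.
  move=> ij; have [x x0 Px] := exists_orthogonal ((jmx P : 'M_3) j i).
  have PU : jip P (hunit i j x) = 0 by rewrite jip_hunit Px mulr0.
  have UU : jip (hunit i j x) (hunit i j x) = onorm x * 2.
    by rewrite -jtr_jmul hunit_sqr // jtrZ jtrD !jtr_jdiag.
  have := PE (hunit i j x) (hunit i j x).
  rewrite jformE hunit_sqr // jipZr jipDr PU UU jtr_hunit //; jatoms.
  by move: (onorm x) x0; clear=> n n0 *; apply: (mulfI n0); lra.
have trP : jtr P = jip P (jdiag 0) + jip P (jdiag 1) + jip P (jdiag 2).
  rewrite /jtr !big_ord_recl big_ord0 addr0 !jip_jdiag addrA.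
  by congr (oRe _ + oRe _ + oRe _); congr fun_of_matrix; apply: val_inj.
have trP3 : jtr P = 3.
  move: trP (diag 0 1 isT) (diag 0 2 isT) (diag 1 2 isT).
  by jatoms; clear=> *; lra.
apply/eqP; rewrite -subr_eq0; apply/eqP/jip_eq0.
rewrite !(jipDl, jipDr, jipNl, jipNr) PP (jipC P (jE R)) !jip1l jtr1 trP3.
by ring.
Qed.

End HermitianUnits.

(** * Polarization *)

(** The expansions of D (x + y) and of D (- x + y) on the diagonal give
    D x x y + D x y y = 0 and D x x y - D x y y = 0; the resulting D x x y = 0
    is then polarized in its first two arguments. *)
Lemma trilinear_polarization (K : numFieldType) (V : zmodType)
    (D : V -> V -> V -> K) :
  (forall x y z w, D (x + y) z w = D x z w + D y z w) ->
  (forall x y z, D x y z = D y x z) -> (forall x y z, D x y z = D x z y) ->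
  (forall x, D x x x = 0) -> forall x y z, D x y z = 0.
Proof.
move=> D1 Cl Cr D0.
have D2 x y z w : D x (y + z) w = D x y w + D x z w.
  by rewrite ![D x _ w]Cl D1.
have D3 x y z w : D x y (z + w) = D x y z + D x y w.
  by rewrite ![D x y _]Cr D2.
have D10 y z : D 0 y z = 0 by apply: (addIr (D 0 y z)); rewrite -D1 !add0r.
have DN x y z : D (- x) y z = - D x y z.
  by apply/eqP; rewrite -addr_eq0 -D1 addNr D10.
have Dsum x y : D x x y + D x y y = 0.
  have := D0 (x + y); rewrite !(D1, D2, D3) !D0.
  rewrite (Cr x y x) (Cl y x x) (Cr x y x) (Cl y x y) (Cr y y x) (Cl y x y).
  move: (D x x y) (D x y y) => s t st.
  by apply: (mulfI (_ : 3 != 0)); rewrite ?pnatr_eq0 // mulr0 -st; ring.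
have Dxx x y : D x x y = 0.
  have := Dsum (- x) y; rewrite DN (Cl x) DN opprK DN => /eqP.
  rewrite subr_eq0 => /eqP eqD; have := Dsum x y; rewrite -eqD -mulr2n => /eqP.
  by rewrite mulrn_eq0 => /eqP.
move=> x y z; have := Dxx (x + y) z; rewrite D1 !D2 !Dxx add0r addr0 (Cl y).
by rewrite -mulr2n => /eqP; rewrite mulrn_eq0 => /eqP.
Qed.

(** * Automorphisms of the Jordan algebra *)

Section Automorphisms.
Variable R : realType.
Implicit Types (b : GL (jordan R)) (X Y Z : jordan R).

Lemma F4_1 b : F4 R b -> b (jE R) = jE R.
Proof.
move=> hb; have bX X : jmul (b (jE R)) X = X.
  by rewrite -{1}(GLVK b X) -hb jmul1l GLVK.
by rewrite -[RHS]bX jmulC jmul1l.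
Qed.

(** An automorphism turns tr into an associative functional with the same value
    at the unit. *)
Lemma F4_jtr b X : F4 R b -> jtr (b X) = jtr X.
Proof.
move=> hb; pose f Y := jtr (b Y).
have fE Y : f Y = f (jdiag R ord0) * jtr Y.
  apply: associative_traceE => {Y} [Y Z|k Y|Y Z W].
  - by rewrite /f linearD jtrD.
  - by rewrite /f linearZ jtrZ.
  - by rewrite /f !hb !jtr_jmul jip_mulA.
have f1 : f (jdiag R ord0) = 1.
  have := fE (jE R); rewrite {1}/f F4_1 // jtr1 -{1}[3]mul1r.
  by move=> /mulIf ->; rewrite ?pnatr_eq0.
by rewrite -/(f X) fE f1 mul1r.
Qed.

Lemma F4_jip b X Y : F4 R b -> jip (b X) (b Y) = jip X Y.
Proof. by move=> hb; rewrite -!jtr_jmul -hb F4_jtr. Qed.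

Lemma F4_jform b X Y Z : F4 R b -> jform (b X) (b Y) (b Z) = jform X Y Z.
Proof. by move=> hb; rewrite !jformE -hb !F4_jip // !F4_jtr. Qed.

(** The trilinear form (X, Y o Z) is recovered from the invariant forms by
    [jformE], and the product from it by nondegeneracy. *)
Lemma F4_of_forms b : b (jE R) = jE R ->
    (forall X Y, jip (b X) (b Y) = jip X Y) ->
    (forall X Y Z, jform (b X) (b Y) (b Z) = jform X Y Z) ->
  F4 R b.
Proof.
move=> b1 bip bform X Y; apply: jip_inj => Z.
have btr W : jtr (b W) = jtr W by rewrite -!jip1l -{1}b1 bip.
rewrite -(GLVK b Z) bip [LHS]jipC [RHS]jipC.
have := bform (b^-1%g Z) X Y; rewrite !jformE !btr !bip.
by move/addIr->.
Qed.

(** The identity [jform1l] for the unit E involves invariant forms and E only,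
    so it carries over to b E. *)
Lemma form_isometry_fixes1 b :
    (forall X Y, jip (b X) (b Y) = jip X Y) ->
    (forall X Y Z, jform (b X) (b Y) (b Z) = jform X Y Z) ->
  b (jE R) = jE R.
Proof.
move=> bip bform; apply: jform_unit_rigid => [Y Z|]; last first.
  by rewrite bip jip1l jtr1.
by rewrite -(GLVK b Y) -(GLVK b Z) bform !bip jform1l !jip1l.
Qed.

End Automorphisms.

(** * The forms on the complexification *)

Section ComplexForms.
Variable R : realType.
Local Notation JC := (cplx (jordan R)).
Implicit Types (X Y Z W : JC) (a : GL JC) (x y z : jordan R).

Definition JC_form X Y Z : R[i] := JC_ip X (JC_cross Y Z).

Lemma JC_formE X Y Z :
  let: (Cplx x x', Cplx y y', Cplx z z') := (X, Y, Z) in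
  JC_form X Y Z =
  (jform x y z - jform x y' z' - jform x' y z' - jform x' y' z)
  +i* (jform x y z' + jform x y' z + jform x' y z - jform x' y' z').
Proof.
case: X Y Z => [x x'] [y y'] [z z'].
rewrite /JC_form /JC_ip /JC_cross /cplx_form /= !jipDr !jipNr /jform.
by jatoms; congr (_ +i* _); ring.
Qed.

Lemma JC_formCl X Y Z : JC_form X Y Z = JC_form Y X Z.
Proof.
have := (JC_formE X Y Z, JC_formE Y X Z); case: X Y Z => [x x'] [y y'] [z z'].
case=> -> ->; rewrite ![jform _ x _]jformCl ![jform _ x' _]jformCl.
by jatoms; congr (_ +i* _); ring.
Qed.

Lemma JC_formCr X Y Z : JC_form X Y Z = JC_form X Z Y.
Proof.
have := (JC_formE X Y Z, JC_formE X Z Y); case: X Y Z => [x x'] [y y'] [z z'].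
case=> -> ->; rewrite ![jform _ z _]jformCr ![jform _ z' _]jformCr.
by jatoms; congr (_ +i* _); ring.
Qed.

Lemma JC_ipDl X Y Z : JC_ip (X + Y) Z = JC_ip X Z + JC_ip Y Z.
Proof.
case: X Y Z => [x x'] [y y'] [z z']; apply/eqP.
rewrite eq_complex /= !jipDl; jatoms; clear.
by apply/andP; split; apply/eqP; ring.
Qed.

Lemma JC_form1l Y Z : JC_form (JC_E R) Y Z *+ 2 =
  JC_ip (JC_E R) Y * JC_ip (JC_E R) Z - JC_ip Y Z.
Proof.
have := JC_formE (JC_E R) Y Z; case: Y Z => [y y'] [z z'] ->.
rewrite mulr2n /JC_ip /cplx_form; apply/eqP.
rewrite eq_complex /= !jform0l !jip0l !jform1l !jip1l; jatoms; clear.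
by apply/andP; split; apply/eqP; field.
Qed.

Lemma JC_ip11 : JC_ip (JC_E R) (JC_E R) = 3.
Proof.
apply/eqP; rewrite eq_complex /= !jip0l !jip0r jip1l jtr1.
by apply/andP; split; apply/eqP; ring.
Qed.

Lemma JC_ip_real x y : JC_ip (Cplx x 0) (Cplx y 0) = (jip x y)%:C.
Proof. by rewrite /JC_ip /cplx_form /= !jip0l !jip0r subr0 addr0. Qed.

Lemma JC_form_real x y z :
  JC_form (Cplx x 0) (Cplx y 0) (Cplx z 0) = (jform x y z)%:C.
Proof.
have := JC_formE (Cplx x 0) (Cplx y 0) (Cplx z 0) => /= ->.
rewrite !jform0l !(jformCl x 0) !(jformCr x y 0) (jformCl x 0) !jform0l.
by rewrite !subr0 !addr0.
Qed.

Lemma JC_ip_inj X Y : (forall Z, JC_ip X Z = JC_ip Y Z) -> X = Y.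
Proof.
case: X Y => [x x'] [y y'] XY.
have -> : x = y.
  apply: jip_inj => z; have := congr1 (@complex.Re R) (XY (Cplx z 0)).
  by rewrite [LHS]/= [RHS]/= !jip0r; jatoms; rewrite !subr0.
have -> // : x' = y'.
apply: jip_inj => z; have := congr1 (@complex.Im R) (XY (Cplx z 0)).
by rewrite [LHS]/= [RHS]/= !jip0r; jatoms; rewrite !add0r.
Qed.

Lemma E6_form a X Y Z : E6 R a -> JC_form (a X) (a Y) (a Z) = JC_form X Y Z.
Proof.
case=> adet _; apply/eqP; rewrite -subr_eq0; apply/eqP; move: X Y Z.
apply: (@trilinear_polarization R[i] JC
  (fun X Y Z => JC_form (a X) (a Y) (a Z) - JC_form X Y Z)).
- by move=> X Y Z W; rewrite linearD /JC_form !JC_ipDl opprD addrACA.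
- by move=> X Y Z; rewrite JC_formCl (JC_formCl X).
- by move=> X Y Z; rewrite JC_formCr (JC_formCr X).
move=> X; apply/eqP; rewrite subr_eq0; apply/eqP.
by apply: (mulfI _ (adet X)); rewrite invr_eq0 pnatr_eq0.
Qed.

(** With Y = E, [JC_form1l] expresses (E, Z) through the trilinear form, so
    (E, Z) is invariant; then the same identity expresses (Y, Z) through
    invariants. *)
Lemma E6_E_ip a X Y : E6_E R a -> JC_ip (a X) (a Y) = JC_ip X Y.
Proof.
case=> a6 aE.
have form1 Z W : JC_form (JC_E R) (a Z) (a W) = JC_form (JC_E R) Z W.
  by rewrite -{1}aE E6_form.
have ip1 Z : JC_ip (JC_E R) (a Z) = JC_ip (JC_E R) Z.
  have := JC_form1l (JC_E R) (a Z).
  have := form1 (JC_E R) Z; rewrite aE => ->; rewrite JC_form1l JC_ip11.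
  move: (JC_ip _ (a Z)) (JC_ip _ Z) => s t st.
  apply: (@mulfI _ 2); first by rewrite pnatr_eq0.
  have two u : 2 * u = 3 * u - u :> R[i] by ring.
  by rewrite !two st.
have := JC_form1l (a X) (a Y); rewrite form1 JC_form1l !ip1 => /addrI.
move/oppr_inj/esym; apply.
Qed.

(** Both (X, Y) and (tau X, Y) are preserved, and (X, Y) is nondegenerate. *)
Lemma E6_E_tau a : E6_E R a -> forall X, tau (a X) = a (tau X).
Proof.
move=> aE X; have [[_ aherm] _] := aE; apply: JC_ip_inj => Z.
rewrite -(GLVK a Z) [RHS](E6_E_ip _ _ aE); exact: (aherm X (a^-1%g Z)).
Qed.

End ComplexForms.

(** * Complexification of real isomorphisms *)

Section Complexify.
Variable R : realType.
Local Notation J := (jordan R).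
Local Notation JC := (cplx J).
Implicit Types (b c : GL J) (a : GL JC).

Definition complexify_fun b (X : JC) : JC :=
  Cplx (b (cplx_re X)) (b (cplx_im X)).

Lemma complexify_linear b : linear (complexify_fun b).
Proof.
move=> k [x x'] [y y']; apply: cplxP => /=.
  by rewrite linearD linearB !linearZ.
by rewrite !linearD !linearZ.
Qed.

Lemma complexify_bij b : bijective (complexify_fun b).
Proof.
have [c bc cb] := GLbij b.
by exists (fun X => Cplx (c (cplx_re X)) (c (cplx_im X))) => -[x x'];
  rewrite /complexify_fun /= ?bc ?cb.
Qed.

Definition complexify b : GL JC :=
  LinAut (@complexify_linear b) (complexify_bij b).

Lemma complexifyE b x x' : complexify b (Cplx x x') = Cplx (b x) (b x').
Proof. by []. Qed.

Lemma complexify_real b x : complexify b (Cplx x 0) = Cplx (b x) 0.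
Proof. by rewrite complexifyE linear0. Qed.

Lemma complexifyM b c : complexify (b * c)%g = (complexify b * complexify c)%g.
Proof. exact: GL_ext. Qed.

Lemma complexify_inj : injective complexify.
Proof.
move=> b c bc; apply: GL_ext => x.
by have := congr1 (fun a : GL JC => cplx_re (a (Cplx x 0))) bc.
Qed.

Lemma complexify_tau b X : tau (complexify b X) = complexify b (tau X).
Proof.
by case: X => x x'; rewrite /tau /cplx_conj !complexifyE /= linearN.
Qed.

(** The real elements are the fixed points of tau, so they are preserved. *)
Lemma tau_real_part a : (forall X, tau (a X) = a (tau X)) ->
  exists2 f : J -> J, linear f & forall x, a (Cplx x 0) = Cplx (f x) 0.
Proof.
move=> at_; pose f x := cplx_re (a (Cplx x 0)).
have fE x : a (Cplx x 0) = Cplx (f x) 0.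
  apply: cplxP => //=; have := at_ (Cplx x 0).
  rewrite /tau /cplx_conj /= oppr0 => /(congr1 (@cplx_im _)) /= eqN.
  set t := cplx_im _ in eqN *; have: (2 : R) *: t = 0.
    by rewrite scaler_nat mulr2n -{1}eqN addNr.
  by move/eqP; rewrite scaler_eq0 pnatr_eq0 => /eqP.
exists f => // k x y.
have /(congr1 (@cplx_re _)) := GLlin a k%:C (Cplx x 0) (Cplx y 0).
rewrite !fE /= !scale0r !subr0 => <-; rewrite /f; congr (cplx_re (a _)).
by apply: cplxP => /=; rewrite ?scale0r ?scaler0 ?subr0 ?addr0.
Qed.

Lemma tau_complexify a : (forall X, tau (a X) = a (tau X)) ->
  exists b, a = complexify b.
Proof.
move=> at_; have [f flin fE] := tau_real_part at_.
have aVt X : tau (a^-1%g X) = a^-1%g (tau X).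
  by apply: (bij_inj (GLbij a)); rewrite -at_ !GLVK.
have [g _ gE] := tau_real_part aVt.
have fg : cancel g f.
  by move=> x; have := GLVK a (Cplx x 0); rewrite gE fE => -[].
have gf : cancel f g.
  move=> x; have : a^-1%g (a (Cplx x 0)) = Cplx x 0.
    by apply: (bij_inj (GLbij a)); rewrite GLVK.
  by rewrite fE gE => -[].
pose c : GL J := LinAut flin (Bijective gf fg).
have ca x : a (Cplx x 0) = complexify c (Cplx x 0).
  by rewrite fE complexify_real.
exists c; apply: GL_ext => -[x x'].
have -> : Cplx x x' = (0 +i* 1) *: Cplx x' 0 + Cplx x 0.
  apply: cplxP => /=; first by rewrite scale0r scaler0 subr0 add0r.
  by rewrite scale1r scaler0 add0r addr0.
by rewrite (GLlin a) (GLlin (complexify c)) !ca.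
Qed.

Lemma E6_complexify b : E6 R (complexify b) ->
  (forall x y, jip (b x) (b y) = jip x y) /\
  (forall x y z, jform (b x) (b y) (b z) = jform x y z).
Proof.
move=> b6; split=> [x y|x y z].
  have [_ /(_ (Cplx x 0) (Cplx y 0))] := b6.
  rewrite /JC_herm complexify_tau /tau /cplx_conj oppr0 !complexify_real.
  rewrite !JC_ip_real => /complexI; apply.
have := E6_form (Cplx x 0) (Cplx y 0) (Cplx z 0) b6.
rewrite !complexify_real !JC_form_real => /complexI; apply.
Qed.

Lemma E6_tauE : E6_tau R = E6_E R.
Proof.
apply/seteqP; split=> a [a6 ha]; split=> //; last exact: E6_E_tau.
have [b ab] := tau_complexify ha.
move: a6; rewrite ab => /E6_complexify[bip bf].
by rewrite complexify_real form_isometry_fixes1.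
Qed.

Lemma F4_complexify b : F4 R b <-> E6_E R (complexify b).
Proof.
split=> [hb|[b6 bE]]; last first.
  have [bip bf] := E6_complexify b6.
  by apply: F4_of_forms => //; apply: form_isometry_fixes1.
have bip X Y : JC_ip (complexify b X) (complexify b Y) = JC_ip X Y.
  by case: X Y => [x x'] [y y']; rewrite /JC_ip /cplx_form /= !F4_jip.
have bform X : JC_form (complexify b X) (complexify b X) (complexify b X) =
               JC_form X X X.
  case: X => x x'; rewrite complexifyE.
  have := JC_formE (Cplx (b x) (b x')) (Cplx (b x) (b x')) (Cplx (b x) (b x')).
  move=> ->; rewrite !F4_jform //.
  by have := JC_formE (Cplx x x') (Cplx x x') (Cplx x x') => ->.
split; last by rewrite complexify_real F4_1.
split=> [X|X Y]; first exact: (congr1 ( *%R 3^-1) (bform X)).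
by rewrite /JC_herm complexify_tau bip.
Qed.

End Complexify.

(** * The theorem *)

Theorem theorem3p7p1 (R : realType) :
  E6_tau R = E6_E R /\ isomorphic_subgroups (E6_E R) (F4 R).
Proof.
split; first exact: E6_tauE.
(* phi is inverse to complexification on the stabilizer of E. *)
have /choice[phi phiP] : forall a : GL (cplx (jordan R)),
    exists b, E6_E R a -> a = complexify b.
  move=> a; have [aE|naE] := pselect (E6_E R a); last by exists 1%g.
  by have [b ->] := tau_complexify (E6_E_tau aE); exists b.
exists phi; split; first split.
- by move=> a aE; apply/F4_complexify; rewrite -phiP.
- move=> a c /set_mem aE /set_mem cE eq_phi.
  by rewrite (phiP a aE) (phiP c cE) eq_phi.
- move=> b /F4_complexify bE; exists (complexify b) => //.
  by apply: complexify_inj; rewrite -(phiP _ bE).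
move=> a c aE cE; apply: complexify_inj.
have acE : E6_E R (a * c)%g.
  case: aE cE => [[adet aherm] a1] [[cdet cherm] c1]; split; last first.
    by rewrite GLM c1 a1.
  by split=> [X|X Y]; rewrite !GLM; [rewrite adet cdet|rewrite aherm cherm].
by rewrite complexifyM -(phiP _ acE) -(phiP _ aE) -(phiP _ cE).
Qed.
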